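(* Let $(p_n)_{n\ge 3}$ be a sequence in $(0,1)$ with $$p_n\longrightarrow 0\quad\text{and}\quad \frac{\log n}{np_n}\longrightarrow 0\qquad\text{as } n\to\infty ,$$ and let $L_n$ denote the length (number of vertices) of the longest path in the homogeneous Erdős–Rényi random graph $G(n,p_n)$. Then: (i) For any $0<\delta<\frac12$, $$\mathbb{E}L_n\ \ge\ n-2n e^{-(1-\delta)np_n^2}\qquad\text{and}\qquad \mathbb{P}\left(L_n\ge n-2n e^{-(1-2\delta)np_n^2}\right)\ \ge\ 1-e^{-\delta np_n^2}$$ for all $n$ large. (ii) Suppose in addition that $np_n^2=M\log n$ for all $n$ large, for some constant $M>1$. Then for any $1<M_1<M$, $$\mathbb{E}L_n\ \ge\ n-\frac{2}{n^{M_1-1}}\qquad\text{and}\qquad \mathbb{P}(L_n=n)\ \ge\ 1-\frac{2}{n^{M_1-1}}$$ for all $n$ large.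
   Context: The homogeneous Erdős–Rényi random graph $G(n,p_n)$ has vertex set $\{1,\dots,n\}$, and each of the $\binom n2$ possible edges is present independently with the same probability $p_n$. A path is a simple path (distinct vertices, consecutive ones adjacent), and its length is measured as its number of vertices, so that $L_n=n$ means that the graph contains a Hamiltonian path. ''For all $n$ large'' means for all $n\ge n_0$ for some $n_0$ (which may depend on the constants and sequences involved). *)

(* Defs.v *)
From mathcomp Require Import all_boot all_order all_algebra.

Set Implicit Arguments.
Unset Strict Implicit.
Unset Printing Implicit Defensive.

Import Order.TTheory GRing.Theory Num.Theory.
Local Open Scope ring_scope.

Definition possible_edges (n : nat) : {set {set 'I_n}} :=
  [set e : {set 'I_n} | #|e| == 2%N].

(* A simple graph on 'I_n is identified with its edge set
   E \subset possible_edges n; since #|[set x; x]| = 1, adj E is then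
   irreflexive. *)
Definition adj (n : nat) (E : {set {set 'I_n}}) : rel 'I_n :=
  fun x y => [set x; y] \in E.

Definition simple_path (n : nat) (E : {set {set 'I_n}}) (s : seq 'I_n) : bool :=
  uniq s && sorted (adj E) s.

(* Number of vertices of a longest simple path.  Bounding k by n loses nothing,
   as simple paths have at most n vertices.  The empty sequence (k = 0) is
   admitted, which only matters when n = 0. *)
Definition longest_path (n : nat) (E : {set {set 'I_n}}) : nat :=
  (\max_(k < n.+1 | [exists t : k.-tuple 'I_n, simple_path E t]) k)%N.

(* G(n,p) as the product of Bernoulli(p) weights over the possible edges. *)
Definition ER_weight (R : numDomainType) (n : nat) (p : R)
    (E : {set {set 'I_n}}) : R :=
  \prod_(e in possible_edges n) (if e \in E then p else 1 - p).

Definition ER_prob (R : numDomainType) (n : nat) (p : R)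
    (A : pred {set {set 'I_n}}) : R :=
  \sum_(E in powerset (possible_edges n) | A E) ER_weight p E.

Definition ER_expect (R : numDomainType) (n : nat) (p : R)
    (X : {set {set 'I_n}} -> R) : R :=
  \sum_(E in powerset (possible_edges n)) ER_weight p E * X E.

Lemma longest_path_ge n (E : {set {set 'I_n}}) (s : seq 'I_n) :
  simple_path E s -> (size s <= longest_path E)%N.
Proof.
move=> sP; have /andP[us _] := sP.
have sn : (size s < n.+1)%N.
  by rewrite ltnS -[leqRHS](card_ord n) -(card_uniqP us) max_card.
rewrite /longest_path -[X in (X <= _)%N]/(nat_of_ord (Ordinal sn)).
rewrite (@leq_bigmax_cond _ _ (fun k : 'I_n.+1 => k : nat)) //=.
by apply/existsP; exists (in_tuple s).
Qed.

Lemma longest_path_witness n (E : {set {set 'I_n}}) :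
  exists2 s, simple_path E s & size s = longest_path E.
Proof.
rewrite /longest_path.
elim/big_ind: _ => [|a b [s ? <-] [t ? <-]|k /existsP[t tP]].
- by exists [::].
- by case: (leqP (size s) (size t)) => _; [exists t | exists s].
- by exists t => //; rewrite size_tuple.
Qed.

(* The edges are mutually independent, each present with probability p. *)
Lemma ER_prob_edges (R : numDomainType) n (p : R) (S : {set {set 'I_n}}) :
  S \subset possible_edges n ->
  ER_prob p (fun E => S \subset E) = p ^+ #|S|.
Proof.
move=> SP; set P := possible_edges n.
pose F e : R := if e \in P then p else 0.
pose G e : R := if e \in P then (if e \in S then 0 else 1 - p) else 1.
have -> : p ^+ #|S| = \prod_e (F e + G e).
  rewrite (bigID [in S]) /= [X in _ * X]big1 ?mulr1 => [|e eS]; last first.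
    by rewrite /F /G (negPf eS); case: ifP => _; rewrite ?add0r // subrKC.
  rewrite (eq_bigr (fun=> p)) ?prodr_const // => e eS.
  by rewrite /F /G (subsetP SP _ eS) eS addr0.
rewrite bigA_distr /ER_prob big_mkcond [RHS]big_mkcond /=.
apply: eq_bigr => E _; rewrite powersetE.
case: ifP => [/andP[EP SE]|/negbT].
  rewrite /ER_weight big_mkcond; apply: eq_bigr => e _.
  rewrite /F /G -/P; case: ifP => eP.
    case: ifP => // /negbT eE; case: ifP => // eS.
    by rewrite (subsetP SE _ eS) in eE.
  by case: ifP => // /(subsetP EP); rewrite -/P eP.
rewrite negb_and => /orP[] /subsetPn[e e1 e2]; rewrite (bigD1 e) //=.
  by rewrite e1 /F (negPf e2) mul0r.
by rewrite (negPf e2) /G (subsetP SP _ e1) e1 mul0r.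
Qed.

Lemma ER_prob_total (R : numDomainType) n (p : R) :
  ER_prob p (fun _ : {set {set 'I_n}} => true) = 1.
Proof.
rewrite -(expr0 p) -[in RHS](cards0 {set 'I_n}) -(ER_prob_edges _ (sub0set _)).
by apply: eq_bigl => E; rewrite sub0set.
Qed.

(* Main.v *)
Require Import Defs.
From mathcomp Require Import all_boot all_order all_algebra.
From mathcomp Require Import all_classical all_reals all_analysis.
(* The lemmas on finite sets must shadow their namesakes on classical sets. *)
From mathcomp Require Import fintype finset ring lra zify.

(** Everything follows from one bound: for fixed [0 < delta < 1/2] and n large,
    the expected number of vertices missed by a longest path is at most
    [2 n exp(-(1-delta) n p^2)].  The probability bound in (i) is Markov's
    inequality applied to [n - L_n]; (ii) is the case [n p^2 = M log n], since
    [L_n <> n] means [n - L_n >= 1].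

    To bound the expectation, the graph is exposed in two independent rounds,
    as the union of G(n,p1) and G(n,p2) with [1 - p = (1 - p1) (1 - p2)],
    [p2 = (1 - eta) p] and [p1 >= eta p], where eta is a small multiple of
    delta.

    First round: depth-first search ([path_or_sparse_cut]) shows that a graph
    without a path of more than [n - 2k] vertices has two disjoint sets of at
    least k vertices with no edge between them.  A union bound over the at most
    [4^n] pairs of sets gives probability at most [4^n (1 - p1)^(k^2)]
    ([bexp_sparse_cut]); with k about [eta n] this is below [exp(-n)], hence
    negligible, because [n p] tends to infinity.

    Second round: the few vertices left over are inserted into the path one at
    a time ([insert_all]).  A vertex v can be inserted between two consecutive
    path vertices as soon as it is adjacent to both.  Each insertion destroys
    only one pair of consecutive original path vertices, so that at least
    [K = n - 4k - 1] such pairs are available throughout, and the edges from v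
    to original path vertices are independent of everything used before.  The
    events that v is adjacent to both ends of a pair overlap for neighbouring
    pairs, but a two-term recursion along the path ([bexp_no_pair]) still bounds
    the probability that all of them fail by [lam^K], with
    [lam = 1 - p2^2 (1 - p2)].  As p tends to 0 and k is about [eta n], this is
    at most [exp(-(1-delta) n p^2)].

    Independence enters through random subsets of an arbitrary finite type in
    which each element e appears independently with its own probability [q e]:
    the union of two independent such subsets is again one ([bexp_setU]).  This
    single fact gives both the two-round exposure (same edges, smaller
    probabilities) and conditioning on some edges (q is split into its
    restrictions to those edges and to the others). *)

Set Implicit Arguments.
Unset Strict Implicit.
Unset Printing Implicit Defensive.

Import Order.TTheory GRing.Theory Num.Theory.
Import numFieldNormedType.Exports.
Local Open Scope ring_scope.

(** * Random subsets with independent elements *)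

Section RandomSubset.
Variables (R : realFieldType) (T : finType).
Implicit Types (q : T -> R) (X Y : {set T} -> R) (E A B D : {set T}) (e : T).

Definition bweight q E : R := \prod_e (if e \in E then q e else 1 - q e).

Definition bexp q X : R := \sum_E bweight q E * X E.

Lemma eq_bexp q X Y : X =1 Y -> bexp q X = bexp q Y.
Proof. by move=> XY; apply: eq_bigr => E _; rewrite XY. Qed.

Lemma bexp_le q X Y : (forall e, 0 <= q e <= 1) -> (forall E, X E <= Y E) ->
  bexp q X <= bexp q Y.
Proof.
move=> q01 XY; apply: ler_sum => E _; apply: ler_wpM2l (XY E).
apply: prodr_ge0 => e _; have /andP[q0 q1] := q01 e.
by case: ifP; rewrite ?subr_ge0.
Qed.

Lemma bexpD q X Y : bexp q (fun E => X E + Y E) = bexp q X + bexp q Y.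
Proof. by rewrite -big_split; apply: eq_bigr => E _; rewrite /= mulrDr. Qed.

Lemma bexpZ q c X : bexp q (fun E => c * X E) = c * bexp q X.
Proof. by rewrite mulr_sumr; apply: eq_bigr => E _; rewrite mulrCA. Qed.

Lemma bexp_sum (I : finType) q (P : pred I) (X : I -> {set T} -> R) :
  bexp q (fun E => \sum_(i | P i) X i E) = \sum_(i | P i) bexp q (X i).
Proof.
by rewrite exchange_big; apply: eq_bigr => E _; rewrite /= mulr_sumr.
Qed.

Lemma bexp_disjoint q D :
  bexp q (fun E => [disjoint E & D]%:R) = \prod_(e in D) (1 - q e).
Proof.
pose F e : R := if e \in D then 0 else q e.
pose G e : R := 1 - q e.
have -> : \prod_(e in D) (1 - q e) = \prod_e (F e + G e).
  rewrite big_mkcond; apply: eq_bigr => e _.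
  by rewrite /F /G; case: ifP => _; rewrite ?add0r // subrKC.
rewrite bigA_distr; apply: eq_bigr => E _.
case: (boolP [disjoint E & D]) => [ED|]; last first.
  rewrite mulr0 disjoints_subset => /subsetPn[e eE]; rewrite inE negbK => eD.
  by rewrite (bigD1 e) //= eE /F eD mul0r.
rewrite mulr1; apply: eq_bigr => e _; case: ifP => // eE.
by rewrite /F (disjointFr ED eE).
Qed.

Lemma bexp_cst q c : bexp q (fun=> c) = c.
Proof.
have {2}-> : c = c * \prod_(e in set0) (1 - q e) by rewrite big_set0 mulr1.
rewrite -bexp_disjoint -bexpZ.
by apply: eq_bexp => E; rewrite disjoint_sym disjoints_subset sub0set mulr1.
Qed.

(** The weights factor over the elements e, and for each e the factor of q is
    the sum of those of q1 and q2 over the ways of distributing the membership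
    of e among the two sets; expanding the product sums over all pairs. *)
Lemma bweight_setU q q1 q2 E : (forall e, 1 - q e = (1 - q1 e) * (1 - q2 e)) ->
  bweight q E =
  \sum_(AB : {set T} * {set T} | AB.1 :|: AB.2 == E)
     bweight q1 AB.1 * bweight q2 AB.2.
Proof.
move=> qE.
pose F (e : T) (j : bool * bool) : R :=
  (if j.1 then q1 e else 1 - q1 e) * (if j.2 then q2 e else 1 - q2 e).
transitivity (\prod_e \sum_(j | (j.1 || j.2) == (e \in E)) F e j).
  apply: eq_bigr => e _.
  rewrite big_mkcond /= -(pair_big xpredT xpredT (fun i j =>
    if (i || j) == (e \in E) then F e (i, j) else 0)) /=.
  rewrite !big_bool /= /F /=; have := qE e.
  by case: ifP => _ h /=; lra.
rewrite bigA_distr_big_dep /=.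
pose f (AB : {set T} * {set T}) : {ffun T -> bool * bool} :=
  [ffun e => (e \in AB.1, e \in AB.2)].
pose g (h : {ffun T -> bool * bool}) : {set T} * {set T} :=
  ([set e | (h e).1], [set e | (h e).2]).
rewrite (reindex f) /=; last first.
  exists g => [[A B] _|h _].
    by rewrite /g; congr pair; apply/setP => e; rewrite inE ffunE.
  by apply/ffunP => e; rewrite ffunE !inE -surjective_pairing.
apply: eq_big => [[A B]|[A B] _] /=.
  apply/familyP/eqP => [h|<- e]; last by rewrite unfold_in ffunE /= inE.
  by apply/setP => e; have := h e; rewrite unfold_in ffunE inE => /eqP.
rewrite /bweight -big_split; apply: eq_bigr => e _.
by rewrite ffunE.
Qed.

(** The source of all independence arguments: with [q1 + q2 = q] of disjoint
    supports it is Fubini's theorem, with q1 and q2 both positive it is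
    sprinkling. *)
Lemma bexp_setU q q1 q2 X : (forall e, 1 - q e = (1 - q1 e) * (1 - q2 e)) ->
  bexp q X = bexp q1 (fun A => bexp q2 (fun B => X (A :|: B))).
Proof.
move=> qE; rewrite /bexp.
under [RHS]eq_bigr do rewrite mulr_sumr.
rewrite pair_big /= (partition_big (fun AB => AB.1 :|: AB.2) xpredT) //=.
apply: eq_bigr => E _; rewrite (bweight_setU _ qE) mulr_suml.
by apply: eq_bigr => AB /eqP <-; rewrite mulrA.
Qed.

(** Total probability, exposing e first; setting its probability to 0 removes e
    from the remaining randomness. *)
Lemma bexp_split q e X :
  bexp q X = (1 - q e) * bexp (fun f => if f == e then 0 else q f) X
     + q e * bexp (fun f => if f == e then 0 else q f) (fun E => X (e |: E)).
Proof.
rewrite (@bexp_setU q (fun f => if f == e then q f else 0)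
  (fun f => if f == e then 0 else q f)); last first.
  by move=> f; case: ifP => _; rewrite subr0 ?mulr1 ?mul1r.
set Y := fun A => _; rewrite {1}/bexp (bigD1 set0) //= (bigD1 [set e]) /=; last first.
  by apply/set0Pn; exists e; rewrite inE.
rewrite [X in _ + (_ + X)]big1 ?addr0 => [|A /andP[A0 Ae]].
  congr (_ * _ + _ * _).
  - rewrite /bweight (bigD1 e) //= inE eqxx big1 ?mulr1 // => f /negPf fe.
    by rewrite inE fe subr0.
  - by apply: eq_bexp => B; rewrite set0U.
  - rewrite /bweight (bigD1 e) //= inE eqxx big1 ?mulr1 // => f /negPf fe.
    by rewrite inE fe subr0.
have /subsetPn[f fA] : ~~ (A \subset [set e]) by rewrite subset1 negb_or A0 Ae.
rewrite inE => /negPf fe.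
by rewrite /bweight (bigD1 f) //= fA fe !mul0r.
Qed.

End RandomSubset.

(** * Pairs of consecutive random elements in a sequence *)

Section ConsecutivePairs.
Variable V : eqType.
Implicit Types (P U : pred V) (s t : seq V).

Fixpoint npairs P s : nat :=
  if s is x :: t then ((P x && oapp P false (ohead t)) + npairs P t)%N else 0%N.

Lemma eq_in_npairs P P' s : {in s, P =1 P'} -> npairs P s = npairs P' s.
Proof.
elim: s => //= x s IHs PP'.
rewrite IHs => [|y ys]; last by rewrite PP' // inE ys orbT.
rewrite PP' ?mem_head //; congr (_ && _ + _)%N.
by case: s PP' {IHs} => //= y s PP'; rewrite PP' // !inE eqxx orbT.
Qed.

Lemma npairs_mem s : npairs [in s] s = (size s).-1.
Proof.
rewrite (@eq_in_npairs _ predT) => [|x -> //].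
elim: s => // x [|y s] //= [->] //.
Qed.

End ConsecutivePairs.

Section NoRandomPair.
Variables (R : realFieldType) (V T : finType) (f : V -> T) (U : pred V).
Variables p lam : R.
Hypothesis p01 : 0 <= p <= 1.
(* With a_c the probability that a run of c + 1 independent trials has no two
   consecutive successes, a_1 = 1 - p^2 and
   a_(c+2) = (1 - p) a_(c+1) + p (1 - p) a_c; the bounds on lam below are what
   makes lam^c a supersolution. *)
Hypothesis lam_ge0 : 0 <= lam.
Hypothesis lam1 : 1 - p ^+ 2 <= lam.
Hypothesis lam2 : (1 - p) * (lam + p) <= lam ^+ 2.

(** The recursion looks at the first two entries x, y, both in U: either x is
    absent and the pairs of [y :: t] remain, or x is present, which forces y to
    be absent and leaves the pairs of t.  Entries outside U cut s into runs, and
    the bound is multiplicative over runs because a run without pairs has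
    probability exactly 1 of containing none. *)
Lemma bexp_no_pair (s : seq V) (q : T -> R) :
  (forall e, 0 <= q e <= 1) -> uniq (map f s) ->
  {in s, forall x, U x -> q (f x) = p} ->
  bexp q (fun E => (npairs (fun x => U x && (f x \in E)) s == 0%N)%:R)
    <= lam ^+ npairs U s.
Proof.
have [m] := ubnP (size s); elim: m s q => // m IHm [|x s] q sm q01.
  by rewrite bexp_cst.
case: s sm => [_ _ _|y t sm].
  apply: le_trans (bexp_le (Y := fun=> 1) q01 _) _ => [E|].
    by rewrite lern1 leq_b1.
  by rewrite bexp_cst /= andbF.
move=> us qp.
have uyt : uniq (map f (y :: t)) by move: us => /andP[].
have qyt : {in y :: t, forall z, U z -> q (f z) = p}.
  by move=> z zt; apply: qp; rewrite inE zt orbT.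
case: (boolP (U x && U y)) => [/andP[Ux Uy]|Uxy]; last first.
  have -> : npairs U [:: x, y & t] = npairs U (y :: t) by rewrite /= (negPf Uxy).
  apply: le_trans (IHm (y :: t) q sm q01 uyt qyt).
  apply: bexp_le => // E; rewrite ler_nat /=.
  by move: Uxy; case: (U x); case: (U y); rewrite /= ?andbF.
rewrite (bexp_split _ (f x)) qp ?mem_head //.
set q' := (fun e => if e == f x then 0 else q e).
have q'01 e : 0 <= q' e <= 1 by rewrite /q'; case: ifP => // _; rewrite lexx ler01.
have q'E z : z \in y :: t -> q' (f z) = q (f z).
  move=> zt; rewrite /q'; case: eqP => // fzx.
  by move: us => /= /andP[/negP[]]; rewrite -fzx; exact: (map_f f zt).
have h1 : bexp q' (fun E => (npairs (fun z => U z && (f z \in E)) [:: x, y & t] == 0%N)%:R)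
    <= lam ^+ npairs U (y :: t).
  apply: le_trans (IHm (y :: t) q' sm q'01 uyt _) => [|z zt Uz]; last first.
    by rewrite q'E // qyt.
  by apply: bexp_le => // E; rewrite ler_nat /=; case: (_ && _).
pose q'' := (fun e => if e == f y then 0 else q' e).
have q''01 e : 0 <= q'' e <= 1 by rewrite /q''; case: ifP => // _; rewrite lexx ler01.
have h2 : bexp q' (fun E => (npairs (fun z => U z && (f z \in f x |: E))
    [:: x, y & t] == 0%N)%:R) <= (1 - p) * lam ^+ npairs U t.
  rewrite (bexp_split _ (f y)) -/q'' q'E ?mem_head // qyt ?mem_head //.
  rewrite [X in _ + _ * X](@eq_bexp _ _ _ _ (fun=> 0)); last first.
    by move=> E; rewrite /= Ux Uy !inE !eqxx !orbT.
  rewrite bexp_cst mulr0 addr0 ler_wpM2l ?subr_ge0 //; first by case/andP: p01.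
  have ut : uniq (map f t) by move: uyt => /andP[].
  apply: le_trans (IHm t q'' _ q''01 ut _).
  - apply: bexp_le => // E; rewrite ler_nat.
    rewrite -(@eq_in_npairs _ (fun z => U z && (f z \in f x |: E))) /=.
      by case: (npairs _ t) => [|i]; [case: (_ == _) | rewrite !addnS].
    move=> z zt /=; rewrite !inE.
    case: eqP => // fzx; move: us => /= /andP[/negP[]]; rewrite -fzx.
    by rewrite inE map_f ?orbT.
  - by rewrite /= in sm; lia.
  - move=> z zt Uz; rewrite /q''; case: eqP => [fzy|_].
      by move: uyt => /= /andP[/negP[]]; rewrite -fzy map_f.
    by rewrite q'E ?qyt // inE zt orbT.
case/andP: p01 => p0 p1.
apply: le_trans (lerD (ler_wpM2l _ h1) (ler_wpM2l p0 h2)) _; first by rewrite subr_ge0.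
rewrite /= Ux Uy /=.
set c := npairs U t.
have lc : 0 <= lam ^+ c by rewrite exprn_ge0.
case: (oapp U false (ohead t)); rewrite ?add0n ?add1n !exprS.
  by have := ler_wpM2r lc lam2; lra.
by have := ler_wpM2r lc lam1; lra.
Qed.

End NoRandomPair.

(** * Paths in a fixed graph *)

Lemma adj_sym n (G : {set {set 'I_n}}) : symmetric (adj G).
Proof. by move=> x y; rewrite /adj setUC. Qed.

Lemma simple_pathS n (G H : {set {set 'I_n}}) s :
  G \subset H -> simple_path G s -> simple_path H s.
Proof.
move=> GH /andP[us ps]; rewrite /simple_path us.
by apply: sub_sorted ps => x y; apply: (subsetP GH).
Qed.

(** P marks vertices adjacent to v.  As v is not in U, inserting it between two
    vertices of U destroys exactly one consecutive pair of U. *)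
Lemma insert_between n (G : {set {set 'I_n}}) (P U : pred 'I_n) s v :
  simple_path G s -> v \notin s -> ~~ U v ->
  (forall x, P x -> U x && adj G v x) -> (0 < npairs P s)%N ->
  exists s', [/\ simple_path G s', perm_eq s' (v :: s) &
                 npairs U s = (npairs U s').+1].
Proof.
move=> /andP[us ps] vs Uv PU s_gt0.
(* The first vertex is kept, so that the induction can put x back in front. *)
suff [s' [ps' ss' Us' _]] : exists s', [/\ sorted (adj G) s', perm_eq s' (v :: s),
    npairs U s = (npairs U s').+1 & ohead s' = ohead s].
  by exists s'; split=> //; rewrite /simple_path ps' (perm_uniq ss') /= vs us.
elim: s ps s_gt0 {us vs} => //= x s IHs.
case: (posnP (npairs P s)) => [->|s_gt0].
  case: s {IHs} => [|y t]; first by rewrite andbF.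
  rewrite /= addn0 => /andP[_ yt]; case: (boolP (P x)) => // /PU /andP[Ux vx].
  case: (boolP (P y)) => // /PU /andP[Uy vy] _.
  exists [:: x, v, y & t]; split=> //=.
  - by rewrite vy yt adj_sym vx.
  - by rewrite -(cat1s x) -(cat1s v) perm_catCA.
  - by rewrite Ux Uy (negPf Uv).
move=> xs _; have [s' [ps' ss' Us' hs']] := IHs (path_sorted xs) s_gt0.
exists (x :: s'); split=> //.
- case: s' ps' hs' {ss' Us'} => //= y s' ps' hs'.
  case: s xs hs' {IHs s_gt0} => //= z s /andP[xz _] [yz].
  by rewrite yz xz -yz.
- by apply: (@perm_trans _ (x :: v :: s)); rewrite ?perm_cons // -(cat1s x) -(cat1s v) perm_catCA.
- by rewrite /= hs' Us' addnS.
Qed.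

(** Depth-first search: s is the stack, S the set of vertices already popped
    and T that of vertices not yet seen.  The top of the stack either has a
    neighbour in T, which is pushed, or has none and is popped into S without
    creating an edge between S and T.  Each step lowers [#|T| - #|S|] by one,
    from n to -n, and the search is stopped halfway. *)
Lemma path_or_sparse_cut n (G : {set {set 'I_n}}) :
  exists s (S T : {set 'I_n}), [/\ simple_path G s, [disjoint S & T],
    #|S| = #|T|, (size s + 2 * #|S| = n)%N &
    forall x y, x \in S -> y \in T -> ~~ adj G x y].
Proof.
suff [s [S [T]]] : exists s (S T : {set 'I_n}),
    [/\ simple_path G s, perm_eq (s ++ enum S ++ enum T) (enum 'I_n),
      (#|T| + n = #|S| + n)%N & forall x y, x \in S -> y \in T -> ~~ adj G x y].
  move=> [ps sST /addIn ST nST]; exists s, S, T; split=> //.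
  - rewrite disjoints_subset; apply/subsetP => x xS; rewrite inE.
    have := perm_uniq sST; rewrite enum_uniq !cat_uniq => /and3P[_ _].
    move=> /and3P[_ /hasPn h _]; apply/negP => xT.
    by have := h x; rewrite !mem_enum => /(_ xT); rewrite /= xS.
  - by have := perm_size sST; rewrite !size_cat size_enum_ord -!cardE ST addnn -mul2n.
(* d is the number of steps made. *)
have H d : (d <= n)%N -> exists s (S T : {set 'I_n}),
    [/\ simple_path G s, perm_eq (s ++ enum S ++ enum T) (enum 'I_n),
      (#|T| + d = #|S| + n)%N & forall x y, x \in S -> y \in T -> ~~ adj G x y]; last exact: H (leqnn n).
elim: d => [_|d IHd dn].
  exists [::], set0, setT; rewrite enum_set0 /= cards0 cardsT card_ord addn0.
  split=> //; last by move=> x y; rewrite inE.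
  by rewrite enum_setT enumT.
have [s [S [T [/andP[us ps] sST ST nST]]]] := IHd (ltnW dn).
have /card_gt0P[t0 t0T] : (0 < #|T|)%N by lia.
have permT t : t \in T -> perm_eq ((t :: s) ++ enum S ++ enum (T :\ t)) (enum 'I_n).
  move=> tT; apply: perm_trans sST.
  have tTE : perm_eq (enum T) (t :: enum (T :\ t)).
    rewrite uniq_perm ?enum_uniq //=; first by rewrite mem_enum !inE eqxx enum_uniq.
    by move=> z; rewrite inE !mem_enum !inE; case: eqP => // ->.
  by apply/permP => a; rewrite /= !count_cat (permP tTE) /=; lia.
have goT t : t \in T -> sorted (adj G) (t :: s) -> exists s (S T : {set 'I_n}),
    [/\ simple_path G s, perm_eq (s ++ enum S ++ enum T) (enum 'I_n),
      (#|T| + d.+1 = #|S| + n)%N & forall x y, x \in S -> y \in T -> ~~ adj G x y].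
  move=> tT pt; exists (t :: s), S, (T :\ t); split.
  - have := perm_uniq (permT t tT).
    by rewrite enum_uniq /simple_path pt andbT cat_uniq => /andP[].
  - exact: permT.
  - by have := cardsD1 t T; rewrite tT; lia.
  - by move=> x y xS; rewrite !inE => /andP[_]; apply: nST.
case: s us ps sST permT goT => [|x s] us ps sST permT goT.
  exact: (goT t0 t0T).
case: (pickP [pred t in T | adj G t x]) => [t /andP[/= tT tx]|nx].
  by apply: (goT t tT); rewrite /= tx.
have xS : x \notin S.
  have := perm_uniq sST; rewrite enum_uniq /= mem_cat negb_or mem_cat negb_or.
  by rewrite !mem_enum => /andP[/and3P[]].
exists s, (x |: S), T; split=> //.
- by rewrite /simple_path; move: us => /= /andP[_ ->]; apply: path_sorted ps.
- apply: perm_trans sST.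
  have xSE : perm_eq (enum (x |: S)) (x :: enum S).
    rewrite uniq_perm ?enum_uniq //=; first by rewrite mem_enum xS enum_uniq.
    by move=> z; rewrite inE !mem_enum !inE.
  by apply/permP => a; rewrite /= !count_cat (permP xSE) /=; lia.
- by rewrite cardsU1 xS; lia.
- move=> z y; rewrite inE => /orP[]; last exact: nST.
  by rewrite inE => /eqP -> yT; have := nx y; rewrite /= yT /= adj_sym => ->.
Qed.

(** * The expected length of a longest path, for fixed n *)

Section LongestPath.
Variables (R : realFieldType) (n : nat).
Implicit Types (G : {set {set 'I_n}}) (s : seq 'I_n) (p : R).

Definition edge_prob p (e : {set 'I_n}) : R :=
  if e \in possible_edges n then p else 0.

Lemma edge_prob01 p e : 0 <= p <= 1 -> 0 <= edge_prob p e <= 1.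
Proof. by rewrite /edge_prob; case: ifP => // _; rewrite lexx ler01. Qed.

Lemma ER_expectE p (X : {set {set 'I_n}} -> R) :
  ER_expect p X = bexp (edge_prob p) X.
Proof.
rewrite /ER_expect /bexp big_mkcond; apply: eq_bigr => E _.
rewrite powersetE; case: ifP => [EP|/negbT/subsetPn[e eE eP]]; last first.
  by rewrite /bweight (bigD1 e) //= eE /edge_prob (negPf eP) !mul0r.
congr (_ * _); rewrite /ER_weight big_mkcond; apply: eq_bigr => e _.
rewrite /edge_prob; case: ifP => // eP; case: ifP; rewrite ?subr0 //.
by move=> /(subsetP EP); rewrite eP.
Qed.

Lemma ER_probE p (A : pred {set {set 'I_n}}) :
  ER_prob p A = bexp (edge_prob p) (fun E => (A E)%:R).
Proof.
rewrite -ER_expectE /ER_prob /ER_expect big_mkcondr.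
by apply: eq_bigr => E _; case: (A E); rewrite ?mulr1 ?mulr0.
Qed.

Lemma longest_path_le G : (longest_path G <= n)%N.
Proof. by apply/bigmax_leqP => i _; rewrite -ltnS. Qed.

Section Insertion.
Variables p lam : R.
Hypothesis p01 : 0 <= p <= 1.
Hypothesis lam01 : 0 <= lam <= 1.
Hypothesis lam1 : 1 - p ^+ 2 <= lam.
Hypothesis lam2 : (1 - p) * (lam + p) <= lam ^+ 2.

(** U is the set of vertices of the original path.  Inserting v only uses the
    edges at v, so the process for the remaining vertices sees fresh edges: q is
    split into q1, on the edges containing v, and q2, on the others.  Whether or
    not v fits, the remaining vertices keep at least k usable pairs each, and
    every vertex fails with probability at most [lam ^+ k]. *)
Lemma insert_all (U : pred 'I_n) (k : nat) (vs : seq 'I_n) G s (q : {set 'I_n} -> R) :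
  (forall e : {set 'I_n}, 0 <= q e <= 1) -> simple_path G s -> uniq vs ->
  {in vs, forall v : 'I_n, [/\ v \notin s, ~~ U v &
    forall u, U u -> q [set v; u] = p]} ->
  (k + size vs <= npairs U s)%N ->
  (size s)%:R + (size vs)%:R * (1 - lam ^+ k)
    <= bexp q (fun E => (longest_path (G :|: E))%:R).
Proof.
case/andP: lam01 => lam_ge0 lam_le1.
elim: vs G s q => [|v vs IHvs] G s q q01 Gs /=.
  move=> _ _ _; rewrite mul0r addr0 -[leLHS](bexp_cst q).
  apply: bexp_le => // E; rewrite ler_nat longest_path_ge //.
  exact: simple_pathS (subsetUl _ _) Gs.
move=> /andP[vvs uvs] hvs ks.
have [vs_s Uv qv] := hvs v (mem_head _ _).
pose q1 (e : {set 'I_n}) := if v \in e then q e else 0.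
pose q2 (e : {set 'I_n}) := if v \in e then 0 else q e.
have q1_01 e : 0 <= q1 e <= 1 by rewrite /q1; case: ifP => // _; rewrite lexx ler01.
have q2_01 e : 0 <= q2 e <= 1 by rewrite /q2; case: ifP => // _; rewrite lexx ler01.
rewrite (@bexp_setU _ _ q q1 q2); last first.
  by move=> e; rewrite /q1 /q2; case: ifP => _; rewrite subr0 ?mulr1 ?mul1r.
pose P (A : {set {set 'I_n}}) := fun x : 'I_n => U x && ([set v; x] \in A).
have hvs' u : u \in vs -> [/\ u \notin s, ~~ U u &
    forall w, U w -> q2 [set u; w] = p].
  move=> uvs'; have [-> -> qu] := hvs u (@mem_behead _ (v :: vs) _ uvs').
  split=> // w Uw; rewrite /q2 !inE.
  have /negPf -> : v != u by apply: contraNneq vvs => ->.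
  have /negPf -> : v != w by apply: contraNneq Uv => ->.
  exact: qu.
have fail : bexp q1 (fun A => (npairs (P A) s == 0%N)%:R) <= lam ^+ k.
  have us : uniq (map (fun x : 'I_n => [set v; x]) s).
    have /andP[us _] := Gs.
    rewrite map_inj_in_uniq // => x y xs ys /setP /(_ x).
    rewrite !inE eqxx orbT => /esym/orP[] /eqP // xv.
    by rewrite -xv xs in vs_s.
  have h := @bexp_no_pair _ _ _ (fun x : 'I_n => [set v; x]) U p lam p01 lam_ge0
    lam1 lam2 s q1 q1_01 us.
  apply: le_trans (h _) _.
    by move=> x _ Ux; rewrite /q1 !inE eqxx /= qv.
  by apply: ler_wiXn2l => //; exact: leq_trans (leq_addr _ _) ks.
pose c := (size s)%:R + (size vs)%:R * (1 - lam ^+ k).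
(* Given the edges A at v: v counts for one more vertex unless it fails. *)
have step A : c + 1 + (-1) * (npairs (P A) s == 0%N)%:R
    <= bexp q2 (fun B => (longest_path (G :|: (A :|: B)))%:R).
  under eq_bexp do rewrite setUA.
  have GA : simple_path (G :|: A) s := simple_pathS (subsetUl _ _) Gs.
  case: (posnP (npairs (P A) s)) => [_|s_gt0].
    rewrite mulN1r addrK; apply: (IHvs _ _ _ q2_01 GA uvs hvs').
    by move: ks; rewrite addnS => /ltnW.
  rewrite mulN1r oppr0 addr0.
  have [|s' [Gs' ss' Us']] := @insert_between n (G :|: A) (P A) U s v GA vs_s Uv _ s_gt0.
    by move=> x /andP[-> xA]; rewrite /adj inE xA orbT.
  have := IHvs (G :|: A) s' q2 q2_01 Gs' uvs.
  rewrite (perm_size ss') /= -[(size s).+1]addn1 natrD addrAC; apply.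
    move=> u uvs'; have [us Uu qu] := hvs' u uvs'; split=> //.
    rewrite (perm_mem ss') inE negb_or us andbT.
    by apply: contraNneq vvs => <-.
  by move: ks; rewrite Us' addnS ltnS.
apply: le_trans (bexp_le q1_01 step).
rewrite bexpD bexp_cst bexpZ /c -[(size vs).+1]addn1 natrD; lra.
Qed.

End Insertion.

Definition edge_cut (S T : {set 'I_n}) : {set {set 'I_n}} :=
  [set [set xy.1; xy.2] | xy in setX S T].

Lemma edge_cut_possible (S T : {set 'I_n}) :
  [disjoint S & T] -> edge_cut S T \subset possible_edges n.
Proof.
move=> ST; apply/subsetP => _ /imsetP[[x y] /setXP[/= xS yT] ->].
rewrite inE cards2; have -> // : x != y.
by apply: contraTneq xS => ->; rewrite (disjointFl ST).
Qed.

Lemma card_edge_cut (S T : {set 'I_n}) :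
  [disjoint S & T] -> #|edge_cut S T| = (#|S| * #|T|)%N.
Proof.
move=> ST; rewrite card_in_imset ?cardsX //.
move=> [x y] [x' y'] /setXP[/= xS yT] /setXP[/= xS' yT'] /setP e.
have xy' z : z \in S -> z != y' /\ z != y.
  by move=> zS; split; apply: contraTneq zS => ->; rewrite (disjointFl ST).
have [[xy1 xy2] [xy3 xy4]] := (xy' x xS, xy' x' xS').
have /= := e x; rewrite !inE eqxx (negPf xy1) orbF => /esym/eqP xx'.
have /= := e y; rewrite !inE eqxx orbT -xx' [y == x]eq_sym (negPf xy2).
by move=> /esym/eqP ->; rewrite xx'.
Qed.

(** Union bound over the pairs of disjoint sets with at least k elements: the
    sum dominates the indicator that one of these pairs has no edge in A. *)
Lemma bexp_sparse_cut p (k : nat) : 0 <= p <= 1 ->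
  bexp (edge_prob p) (fun A =>
    \sum_(ST : {set 'I_n} * {set 'I_n} | [&& [disjoint ST.1 & ST.2],
       (k <= #|ST.1|)%N & (k <= #|ST.2|)%N])
      [disjoint A & edge_cut ST.1 ST.2]%:R)
  <= 4 ^+ n * (1 - p) ^+ (k * k).
Proof.
move=> /andP[p0 p1]; rewrite bexp_sum.
have q0 : 0 <= (1 - p) ^+ (k * k) by rewrite exprn_ge0 // subr_ge0.
apply: (@le_trans _ _ (\sum_(ST : {set 'I_n} * {set 'I_n}) (1 - p) ^+ (k * k))).
  rewrite big_mkcond; apply: ler_sum => -[S T] _ /=.
  case: ifP => // /and3P[ST kS kT]; rewrite bexp_disjoint.
  rewrite (eq_bigr (fun=> 1 - p)) => [|e]; last first.
    by move=> /(subsetP (edge_cut_possible ST)) eP; rewrite /edge_prob eP.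
  rewrite prodr_const card_edge_cut // ler_wiXn2l ?subr_ge0 ?gerBl //.
  exact: leq_mul.
rewrite sumr_const card_prod -!cardsT -!powersetT !card_powerset cardsT card_ord.
by rewrite -expnMn -[leLHS]mulr_natl natrX.
Qed.

(** Two-round exposure.  If the first round has a path s with more than
    [n - 2k] vertices, fewer than [2k] vertices are left over, so at least
    [n - 4k - 1] of the [size s - 1] pairs of s survive all the insertions;
    otherwise the trivial bound [0 <= L_n] is used. *)
Lemma expect_longest_path_ge p p1 p2 lam (k : nat) :
  0 <= p1 <= 1 -> 0 <= p2 <= 1 -> 1 - p = (1 - p1) * (1 - p2) ->
  0 <= lam <= 1 -> 1 - p2 ^+ 2 <= lam -> (1 - p2) * (lam + p2) <= lam ^+ 2 ->
  (4 * k < n)%N ->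
  n%:R - n%:R * (4 ^+ n * (1 - p1) ^+ (k * k) + lam ^+ (n - 4 * k - 1))
    <= ER_expect p (fun E : {set {set 'I_n}} => (longest_path E)%:R).
Proof.
move=> p1_01 p2_01 pE lam01 lam1 lam2 kn.
set K := (n - 4 * k - 1)%N.
have /andP[lam_ge0 lam_le1] := lam01.
rewrite ER_expectE (@bexp_setU _ _ _ (edge_prob p1) (edge_prob p2)); last first.
  by move=> e; rewrite /edge_prob; case: ifP => _; rewrite ?subr0 ?mulr1.
pose bad (A : {set {set 'I_n}}) : R :=
  \sum_(ST : {set 'I_n} * {set 'I_n} | [&& [disjoint ST.1 & ST.2],
       (k <= #|ST.1|)%N & (k <= #|ST.2|)%N])
      [disjoint A & edge_cut ST.1 ST.2]%:R.
have n0 : 0 <= n%:R :> R by [].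
have step A : n%:R - n%:R * lam ^+ K + (- n%:R) * bad A
    <= bexp (edge_prob p2) (fun B => (longest_path (A :|: B))%:R).
  have bad_ge0 : 0 <= bad A by apply: sumr_ge0.
  have [s [S [T [As ST cST sS nST]]]] := path_or_sparse_cut A.
  case: (leqP k #|S|) => kS.
    have bad_ge1 : 1 <= bad A.
      rewrite /bad (bigD1 (S, T)) /= ?ST ?kS -?cST ?kS //.
      have -> : [disjoint A & edge_cut S T].
        rewrite disjoint_sym disjoints_subset; apply/subsetP => e.
        by move=> /imsetP[[x y] /setXP[/= xS yT] ->]; rewrite inE nST.
      by rewrite lerDl sumr_ge0.
    apply: (@le_trans _ _ 0).
      have := ler_wpM2l n0 bad_ge1.
      have := mulr_ge0 n0 (exprn_ge0 K lam_ge0); lra.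
    rewrite -[leLHS](bexp_cst (edge_prob p2)); apply: bexp_le => // e.
    exact: edge_prob01.
  have /andP[us _] := As.
  pose vs := enum [set v | v \notin s].
  have svs : (size s + size vs = n)%N.
    rewrite -(card_uniqP us) -cardE.
    have -> : #|[set v | v \notin s]| = #|[predC s]|.
      by apply: eq_card => v; rewrite !inE.
    by rewrite cardC card_ord.
  have := @insert_all p2 lam p2_01 lam01 lam1 lam2 [in s] K vs A s (edge_prob p2).
  have q01 e := @edge_prob01 p2 e p2_01.
  move=> /(_ q01 As (enum_uniq _)) h.
  apply: le_trans (h _ _).
  - have lK := exprn_ge0 K lam_ge0.
    have vn : (size vs)%:R <= n%:R :> R by rewrite ler_nat -[leqRHS]svs leq_addl.
    have := ler_wpM2r lK vn; have := mulr_ge0 n0 bad_ge0.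
    have : (size s)%:R + (size vs)%:R = n%:R :> R by rewrite -natrD svs.
    lra.
  - move=> v; rewrite mem_enum inE => vs'; split=> //= u us'.
    rewrite /edge_prob inE cards2; have -> // : v != u.
    by apply: contraNneq vs' => ->.
  - rewrite npairs_mem /K; move: svs sS kS kn.
    by move: (size s) (size vs) #|S| => a b c; clear; lia.
apply: le_trans (bexp_le (fun e => @edge_prob01 p1 e p1_01) step).
rewrite bexpD bexp_cst bexpZ.
have := ler_wpM2l n0 (bexp_sparse_cut k p1_01); rewrite -/bad; lra.
Qed.

End LongestPath.

(** * Asymptotic estimates *)

(** Markov's inequality, for an event whose indicator dominates an affine
    function of X. *)
Lemma ER_prob_ge (R : realFieldType) (n : nat) (p a b : R)
    (X : {set {set 'I_n}} -> R) (A : pred {set {set 'I_n}}) :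
  0 <= p <= 1 -> (forall E, a + b * X E <= (A E)%:R) ->
  a + b * ER_expect p X <= ER_prob p A.
Proof.
move=> p01 XA; rewrite ER_expectE ER_probE.
rewrite -[X in X + _](bexp_cst (@edge_prob R n p)) -bexpZ -bexpD.
by apply: bexp_le => // e; apply: edge_prob01.
Qed.

Section Estimates.
Variable R : realType.
Implicit Types (n : nat) (p delta : R).

Lemma exprn_le_expR (x y : R) n : 0 <= x -> x <= 1 - y -> x ^+ n <= expR (- (y * n%:R)).
Proof.
move=> x0 xy; rewrite -mulNr expRM_natr; apply: lerXn2r; rewrite ?nnegrE ?expR_ge0 //.
exact: le_trans xy (expR_ge1Dx _).
Qed.

(** Here [eta = delta / 8], [p2 = (1 - eta) p] and k is about [eta n].  The
    losses in the exponent of [lam ^+ K] are factors [(1 - eta)^2] from p2,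
    [1 - p2 >= 1 - eta] from lam and [1 - 5 eta] from K, whose product is at
    least [1 - 8 eta = 1 - delta].  The first-round failure probability is at
    most [exp(2n - eta^3 p n^2)], hence at most [exp(-n)]. *)
Lemma expect_longest_path_exp (n : nat) p delta :
  0 < delta < 1 / 2 -> 0 < p -> p <= delta / 8 -> 5 <= delta / 8 * n%:R ->
  3 <= (delta / 8) ^+ 3 * (n%:R * p) ->
  n%:R - 2 * n%:R * expR (- (1 - delta) * n%:R * p ^+ 2)
    <= ER_expect p (fun E : {set {set 'I_n}} => (longest_path E)%:R).
Proof.
set eta := delta / 8 => /andP[d0 d1] p0 p_eta n_large np_large.
have deltaE : delta = 8 * eta by rewrite /eta mulrC divfK.
have eta0 : 0 < eta by rewrite /eta divr_gt0.
have eta1 : eta < 1 / 16 by lra.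
have n0 : 0 <= n%:R :> R by [].
pose p2 := (1 - eta) * p.
have p20 : 0 <= p2 by rewrite /p2; nra.
have p2p : p2 <= p by rewrite /p2; nra.
have q20 : 0 < 1 - p2 by lra.
pose p1 := eta * p / (1 - p2).
have p1_ge : eta * p <= p1.
  by rewrite /p1 ler_pdivlMr //; have := mulr_ge0 (ltW eta0) (ltW p0); nra.
have p1_ge0 : 0 <= p1 by apply: le_trans p1_ge; rewrite mulr_ge0 // ltW.
have p1_le1 : p1 <= 1 by rewrite /p1 ler_pdivrMr // mul1r /p2; lra.
have pE : 1 - p = (1 - p1) * (1 - p2).
  by rewrite mulrBl mul1r /p1 divfK ?gt_eqF // /p2; lra.
pose lam := 1 - p2 ^+ 2 * (1 - p2).
have p2sq : 0 <= p2 ^+ 2 by exact: sqr_ge0.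
have p2sq1 : p2 ^+ 2 <= 1 by rewrite expr_le1 //; lra.
have lam_ge0 : 0 <= lam by rewrite /lam; nra.
have lam_le1 : lam <= 1 by rewrite /lam; nra.
have lam1 : 1 - p2 ^+ 2 <= lam by rewrite /lam; nra.
have lam2 : (1 - p2) * (lam + p2) <= lam ^+ 2.
  rewrite -subr_ge0.
  have -> : lam ^+ 2 - (1 - p2) * (lam + p2) = p2 ^+ 4 * (1 + (1 - p2) ^+ 2).
    by rewrite /lam; ring.
  by rewrite mulr_ge0 ?exprn_ge0 // addr_ge0 // sqr_ge0.
(* An integer between eta n and eta n + 1. *)
pose k := (Num.truncn (eta * n%:R)).+1.
have en0 : 0 <= eta * n%:R by rewrite mulr_ge0 // ltW.
have k_ge : eta * n%:R <= k%:R.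
  by have /andP[_ /ltW] := truncn_itv en0.
have k_le : k%:R <= eta * n%:R + 1.
  by rewrite /k -natr1 lerD2r; have /andP[] := truncn_itv en0.
have kn : (4 * k < n)%N.
  rewrite -(ltr_nat R) natrM; nra.
pose K := (n - 4 * k - 1)%N.
have K_ge : n%:R * (1 - 5 * eta) <= K%:R.
  have nE : n = (K + 4 * k + 1)%N by rewrite /K; move: (k) kn => j; clear; lia.
  have : n%:R = K%:R + 4 * k%:R + 1 :> R by rewrite [in LHS]nE !natrD natrM.
  lra.
have := @expect_longest_path_ge R n p p1 p2 lam k.
rewrite p1_ge0 p1_le1 p20 lam_ge0 lam_le1 => /(_ isT).
have -> : p2 <= 1 by lra.
move=> /(_ isT pE isT lam1 lam2 kn); apply: le_trans; rewrite -/K.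
set X := expR _.
suff [h1 h2] : 4 ^+ n * (1 - p1) ^+ (k * k) <= X /\ lam ^+ K <= X.
  by have := ler_wpM2l n0 h1; have := ler_wpM2l n0 h2; lra.
split.
  have four : 4 ^+ n <= expR (2 * n%:R) :> R.
    rewrite expRM_natr lerXn2r ?nnegrE ?expR_ge0 //.
    have e2 : (2 : R) <= expR 1 by have := expR_ge1Dx (1 : R); lra.
    have -> : (2 : R) = 1 + 1 by [].
    rewrite expRD; nra.
  have fail : (1 - p1) ^+ (k * k) <= expR (- (3 * n%:R)).
    have h : 0 <= 1 - p1 by lra.
    apply: le_trans (exprn_le_expR _ h (lexx _)) _.
    rewrite ler_expR lerN2 natrM.
    have kk : (eta * n%:R) ^+ 2 <= k%:R * k%:R by rewrite -expr2 lerXn2r ?nnegrE.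
    apply: (@le_trans _ _ (eta * p * (eta * n%:R) ^+ 2)).
      have -> : eta * p * (eta * n%:R) ^+ 2 = eta ^+ 3 * (n%:R * p) * n%:R by ring.
      exact: ler_wpM2r.
    apply: ler_pM => //; [by rewrite mulr_ge0 // ltW | exact: sqr_ge0].
  have q10 : 0 <= (1 - p1) ^+ (k * k) by rewrite exprn_ge0 // subr_ge0.
  have four0 : 0 <= 4 ^+ n :> R by rewrite exprn_ge0.
  apply: le_trans (ler_pM four0 q10 four fail) _.
  rewrite -expRD ler_expR.
  have p_sq : p ^+ 2 <= 1 by rewrite expr_le1 //; lra.
  have : (1 - delta) * p ^+ 2 <= 1 by have := sqr_ge0 p; nra.
  by move=> /(ler_wpM2l n0); lra.
apply: le_trans (exprn_le_expR _ lam_ge0 (lexx _)) _.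
rewrite /X ler_expR !mulNr lerN2 -mulrA.
apply: (@le_trans _ _ ((p2 ^+ 2 * (1 - p2)) * (n%:R * (1 - 5 * eta)))); last first.
  by rewrite ler_wpM2l // mulr_ge0 // ltW.
rewrite /p2 deltaE -/p2.
have -> : ((1 - eta) * p) ^+ 2 * (1 - p2) * (n%:R * (1 - 5 * eta)) =
  ((1 - eta) ^+ 2 * (1 - p2) * (1 - 5 * eta)) * (n%:R * p ^+ 2) by ring.
apply: ler_wpM2r; first by rewrite mulr_ge0 // sqr_ge0.
have a1 : 1 - 2 * eta <= (1 - eta) ^+ 2 by nra.
have a2 : (1 - 2 * eta) * (1 - eta) <= (1 - eta) ^+ 2 * (1 - p2).
  by apply: ler_pM => //; lra.
have a3 : 0 <= 1 - 5 * eta by lra.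
by have := ler_wpM2r a3 a2; nra.
Qed.

End Estimates.

Local Open Scope classical_set_scope.
Local Open Scope ring_scope.

Theorem corollary2 (R : realType) (p : nat -> R)
    (p01 : forall n : nat, (3 <= n)%N -> 0 < p n < 1)
    (p_cvg0 : p n @[n --> \oo] --> (0 : R))
    (log_cvg0 : ln n%:R / (n%:R * p n) @[n --> \oo] --> (0 : R)) :
  (forall delta : R, 0 < delta < 1 / 2 ->
     \forall n \near \oo,
       n%:R - 2 * n%:R * expR (- (1 - delta) * n%:R * p n ^+ 2)
         <= ER_expect (p n) (fun E : {set {set 'I_n}} => (longest_path E)%:R)
       /\
       1 - expR (- delta * n%:R * p n ^+ 2)
         <= ER_prob (p n) (fun E : {set {set 'I_n}} =>
              n%:R - 2 * n%:R * expR (- (1 - 2 * delta) * n%:R * p n ^+ 2)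
                <= (longest_path E)%:R))
  /\
  (forall M : R, 1 < M ->
     (\forall n \near \oo, n%:R * p n ^+ 2 = M * ln n%:R) ->
     forall M1 : R, 1 < M1 < M ->
       \forall n \near \oo,
         n%:R - 2 / n%:R `^ (M1 - 1)
           <= ER_expect (p n) (fun E : {set {set 'I_n}} => (longest_path E)%:R)
         /\
         1 - 2 / n%:R `^ (M1 - 1)
           <= ER_prob (p n) (fun E : {set {set 'I_n}} => longest_path E == n)).
Proof.
have expectation (delta : R) : 0 < delta < 1 / 2 -> \forall n \near \oo,
    n%:R - 2 * n%:R * expR (- (1 - delta) * n%:R * p n ^+ 2)
      <= ER_expect (p n) (fun E : {set {set 'I_n}} => (longest_path E)%:R).
  move=> d01; have /andP[d0 _] := d01.
  have eta0 : 0 < delta / 8 by rewrite divr_gt0.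
  have c0 : 0 < (delta / 8) ^+ 3 / 3 by rewrite divr_gt0 ?exprn_gt0.
  have n3 := nbhs_infty_ge 3.
  have n_large := nbhs_infty_ger (5 / (delta / 8)).
  have ln_ge := nbhs_infty_ger (expR 1 : R).
  have p_small : \forall n \near \oo, p n <= delta / 8.
    exact: (cvgr_le _ p_cvg0 _ eta0).
  have log_small : \forall n \near \oo,
      ln n%:R / (n%:R * p n) <= (delta / 8) ^+ 3 / 3.
    exact: (cvgr_le _ log_cvg0 _ c0).
  apply: (filterS3 _ _ (filterI n3 n_large) ln_ge (filterI p_small log_small)).
  move=> n [{}n3 {}n_large] {}ln_ge [{}p_small {}log_small].
  have /andP[p0 p1] := p01 n n3.
  have n0 : 0 < n%:R :> R by rewrite ltr0n; exact: leq_trans n3.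
  have ln1 : 1 <= ln (n%:R : R) by rewrite -[leLHS]expRK ler_ln ?posrE ?expR_gt0.
  have np0 : 0 < n%:R * p n by rewrite mulr_gt0.
  apply: expect_longest_path_exp => //; first by rewrite [leRHS]mulrC -ler_pdivrMr.
  by move: log_small; rewrite ler_pdivrMr // mulrAC ler_pdivlMr //; lra.
split=> [delta d01|M M1gt npM M1 /andP[M11 M1M]].
  apply: (filterS2 _ _ (nbhs_infty_ge 3) (expectation delta d01)) => n n3 EL.
  have /andP[p0 p1] := p01 n n3.
  have n0 : 0 < n%:R :> R by rewrite ltr0n; exact: leq_trans n3.
  split=> //.
  set a := 2 * n%:R * expR (- (1 - 2 * delta) * n%:R * p n ^+ 2).
  have a0 : 0 < a by rewrite !mulr_gt0 ?expR_gt0.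
  (* Markov: the indicator is at least 1 - (n - L_n) / a. *)
  have : 1 - n%:R / a + a^-1 * ER_expect (p n)
      (fun E : {set {set 'I_n}} => (longest_path E)%:R)
    <= ER_prob (p n) (fun E : {set {set 'I_n}} => n%:R - a <= (longest_path E)%:R).
    apply: ER_prob_ge => [|E]; first by rewrite !ltW.
    have ia : 0 < a^-1 by rewrite invr_gt0.
    have aa : a^-1 * a = 1 by rewrite mulVf ?gt_eqF.
    have Ln : (longest_path E)%:R <= n%:R :> R by rewrite ler_nat longest_path_le.
    case: (lerP (n%:R - a) (longest_path E)%:R) => h /=; nra.
  apply: le_trans.
  have ia : 0 <= a^-1 by rewrite invr_ge0 ltW.
  have := ler_wpM2l ia EL.
  rewrite mulrBr.
  have -> : a^-1 * (2 * n%:R * expR (- (1 - delta) * n%:R * p n ^+ 2)) =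
      expR (- delta * n%:R * p n ^+ 2).
    have -> : - (1 - delta) * n%:R * p n ^+ 2 =
      - (1 - 2 * delta) * n%:R * p n ^+ 2 + - delta * n%:R * p n ^+ 2 by ring.
    by rewrite expRD mulrA -/a mulrA mulVf ?mul1r ?gt_eqF.
  lra.
(* Small enough that (1 - delta) M >= M1. *)
pose delta := (M - M1) / (4 * M).
have M0 : 0 < 4 * M by lra.
have d01 : 0 < delta < 1 / 2.
  by rewrite /delta divr_gt0 ?subr_gt0 //= ltr_pdivrMr //; lra.
have dM : M1 <= (1 - delta) * M.
  have -> : (1 - delta) * M = M - (M - M1) / 4.
    by rewrite /delta; field; lra.
  lra.
apply: (filterS3 _ _ (nbhs_infty_ge 3) npM (expectation delta d01)) => n n3 npMn ELdelta.
have /andP[p0 p1] := p01 n n3.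
have n0 : 0 < n%:R :> R by rewrite ltr0n; exact: leq_trans n3.
have ln0 : 0 <= ln (n%:R : R) by rewrite ln_ge0 // ler1n; exact: leq_trans n3.
have EL : n%:R - 2 / n%:R `^ (M1 - 1)
    <= ER_expect (p n) (fun E : {set {set 'I_n}} => (longest_path E)%:R).
  apply: le_trans ELdelta.
  rewrite lerD2l lerN2 -mulrA ler_pM2l // /powR gt_eqF // -expRN.
  rewrite -{1}(lnK n0) -expRD ler_expR -mulrA npMn.
  by have := ler_wpM2r ln0 dM; lra.
split=> //.
(* The indicator of L_n = n is at least 1 - (n - L_n). *)
have : 1 - n%:R + 1 * ER_expect (p n)
    (fun E : {set {set 'I_n}} => (longest_path E)%:R)
  <= ER_prob (p n) (fun E : {set {set 'I_n}} => longest_path E == n).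
  apply: ER_prob_ge => [|E]; first by rewrite !ltW.
  have := longest_path_le E; rewrite leq_eqVlt.
  case: eqP => [-> _|_ /= Ln]; first by rewrite mul1r subrK.
  have : (longest_path E).+1%:R <= n%:R :> R by rewrite ler_nat.
  by rewrite -natr1; lra.
lra.
Qed.
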